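(* Let $(M,d)$ be a separable metric space and assume that for every countable ordinal $\alpha<\omega_1$ the metric space $(\mathrm{S}_\alpha(\mathbb{Z}),d_\infty)$ coarsely embeds into $(M,d)$. Then there exist $m_0\in M$, non-decreasing functions $\rho,\omega:[0,\infty)\to[0,\infty)$ with $\lim_{t\to\infty}\rho(t)=\infty$, and for every $n\in\mathbb{N}$ a map $F_n:B_n\to M$, where $B_n=\{x\in c_0:\|x\|_\infty\le n\}$, such that $F_n(0)=m_0$ and $\rho(\|x-y\|_\infty)\le d(F_n(x),F_n(y))\le\omega(\|x-y\|_\infty)$ for all $n$ and all $x,y\in B_n$. Consequently, the class of all separable bounded metric spaces embeds equi-coarsely into $(M,d)$.
   Context: Schreier families $\mathrm{S}_\alpha\subset[\mathbb{N}]^{<\omega}$: $\mathrm{S}_0=\{\{n\}:n\in\mathbb{N}\}$; $\mathrm{S}_{\alpha+1}=\{\bigcup_{j=1}^n E_j: n\in\mathbb{N}, E_j\in\mathrm{S}_\alpha, n\le\min E_1,\ \max E_j<\min E_{j+1}\}$; for limit $\beta$ with fixed $(\alpha_n)$ increasing to $\beta$, $\mathrm{S}_\beta=\{A:\exists n,\ n\le\min A,\ A\in\mathrm{S}_{\alpha_n}\}$. $\mathrm{S}_\alpha(\mathbb{Z})=\{\sum_{i\in G}c_ie_i:G\in\mathrm{S}_\alpha,c_i\in\mathbb{Z}\}\subset c_{00}$ with the sup-norm metric $d_\infty$. A map $f$ is a coarse embedding if $\rho(d(x,y))\le d(f(x),f(y))\le\omega(d(x,y))$ for some non-decreasing $\rho,\omega:[0,\infty)\to[0,\infty)$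 with $\rho(t)\to\infty$. A collection of metric spaces embeds equi-coarsely into $Y$ if there are such $\rho,\omega$ working simultaneously for embeddings of all members of the collection. *)

(* Defs.v *)
From Stdlib Require Import Reals ZArith List Sorted Arith.
From Coquelicot Require Import Coquelicot.
Import ListNotations.
Open Scope R_scope.

Inductive bord : Type :=
| OZ : bord
| OS : bord -> bord
| OL : (nat -> bord) -> bord.

Fixpoint ord_le (a b : bord) {struct a} : Prop :=
  match a with
  | OZ => True
  | OS a' =>
      (fix lt_b (b : bord) : Prop :=
         match b with
         | OZ => False
         | OS b' => ord_le a' b'
         | OL g => exists n, lt_b (g n)
         end) b
  | OL f => forall n, ord_le (f n) b
  end.

Definition ord_lt (a b : bord) : Prop := ord_le (OS a) b.
Definition ord_eq (a b : bord) : Prop := ord_le a b /\ ord_le b a.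

(* well-formed trees: limits are taken of strictly increasing sequences;
   these represent exactly the countable ordinals (up to [ord_eq]). *)
Fixpoint ord_wf (a : bord) : Prop :=
  match a with
  | OZ => True
  | OS a' => ord_wf a'
  | OL f => forall n, ord_wf (f n) /\ ord_lt (f n) (f (S n))
  end.

(* A fixed system of fundamental sequences: a set [P] of trees containing
   exactly one representative of every countable ordinal, closed under
   taking immediate subtrees.  The tree in [P] for a limit ordinal beta is
   [OL f], where the paper's fundamental sequence is alpha_n = f (n-1), n>=1. *)
Definition fund_system (P : bord -> Prop) : Prop :=
  (forall t, P t -> ord_wf t) /\
  (forall a, P (OS a) -> P a) /\
  (forall f, P (OL f) -> forall n, P (f n)) /\
  (forall t, ord_wf t -> exists s, P s /\ ord_eq t s) /\
  (forall s s', P s -> P s' -> ord_eq s s' -> s = s').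

(* Finite subsets of N = {1,2,...} are represented by strictly increasing
   lists; min A = hd 0 A for nonempty A. *)
Fixpoint schreier (a : bord) (A : list nat) {struct a} : Prop :=
  match a with
  | OZ => exists k, (0 < k)%nat /\ A = [k]
  | OS a' => exists Es : list (list nat),
      (0 < length Es)%nat /\ (length Es <= hd 0%nat A)%nat /\
      List.Forall (schreier a') Es /\ Sorted lt A /\ A = concat Es
  | OL f => exists n, (S n <= hd 0%nat A)%nat /\ schreier (f n) A
  end.

(* S_alpha(Z) as a subset of c_00 (integer sequences indexed by nat;
   coordinate i is the coefficient of e_i). *)
Definition schreierZ (a : bord) (x : nat -> Z) : Prop :=
  exists G, schreier a G /\ forall i, ~ In i G -> x i = 0%Z.

Definition supnorm (x : nat -> R) : R :=
  real (Lub_Rbar (fun r => exists i, r = Rabs (x i))).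

Definition dinfZ (x y : nat -> Z) : R :=
  supnorm (fun i => IZR (x i - y i)).

Definition c0 (x : nat -> R) : Prop := is_lim_seq x 0.

Definition is_metric {X : Type} (d : X -> X -> R) : Prop :=
  (forall x y, 0 <= d x y) /\ (forall x, d x x = 0) /\
  (forall x y, d x y = 0 -> x = y) /\ (forall x y, d x y = d y x) /\
  (forall x y z, d x z <= d x y + d y z).

Definition separable {X : Type} (d : X -> X -> R) : Prop :=
  exists s : nat -> option X,
    forall x eps, 0 < eps -> exists k y, s k = Some y /\ d x y < eps.

Definition bounded_metric {X : Type} (d : X -> X -> R) : Prop :=
  exists K, forall x y, d x y <= K.

Definition gauges (rho omega : R -> R) : Prop :=
  (forall s t, 0 <= s -> s <= t -> rho s <= rho t /\ omega s <= omega t) /\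
  (forall t, 0 <= t -> 0 <= rho t /\ 0 <= omega t) /\
  (forall K, exists T, forall t, T <= t -> K <= rho t).

Definition coarse_embeds {X Y : Type} (S : X -> Prop) (dX : X -> X -> R)
  (dY : Y -> Y -> R) : Prop :=
  exists (f : X -> Y) (rho omega : R -> R), gauges rho omega /\
    forall x y, S x -> S y ->
      rho (dX x y) <= dY (f x) (f y) <= omega (dX x y).

(* Main.v *)
(** By pigeonhole, uncountably many of the embeddings of the S_a(Z) share, up to
    any given stage, the same gauge values at integer distances and the same
    image of 0, after moving all values into a countable 1-dense subset of M.
    Only finitely many gauge values matter on the ball of radius n.  The tree of
    partial embeddings of the integer grid of radius n, ordered by adding one
    coordinate at a time, is countably branching; the Schreier families give it
    nodes of every countable rank, so it has an infinite branch, which is an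
    embedding of the whole integer grid of radius n in c_00.  Rounding
    coordinates extends it to the ball of c_0, and an explicit Aharoni-type map,
    using only the finitely many scales below the diameter, takes every bounded
    separable space into such a ball with uniform gauges. *)
Require Import Defs.
From Stdlib Require Import Reals ZArith List Sorted Lra Lia Cantor.
From Stdlib Require Import Classical IndefiniteDescription FunctionalExtensionality.
From Coquelicot Require Import Coquelicot.
Import ListNotations.
Set Bullet Behavior "Strict Subproofs".
Open Scope R_scope.

(** * Ordinal trees: order, addition and countable suprema *)

Lemma ord_le_OL (a : bord) (g : nat -> bord) (n : nat) :
  ord_le a (g n) -> ord_le a (OL g).
Proof.
  induction a as [|a IH|f IH]; simpl; auto.
  intros H; exists n; exact H.
Qed.

Lemma ord_le_refl (a : bord) : ord_le a a.
Proof.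
  induction a as [|a IH|f IH]; simpl; auto.
  intros n; apply ord_le_OL with n; auto.
Qed.

Lemma ord_le_trans (a b c : bord) : ord_le a b -> ord_le b c -> ord_le a c.
Proof.
  revert b c; induction a as [|a IHa|f IHf]; intros b c; simpl; auto.
  - induction b as [|b IHb|g IHg]; [contradiction| |].
    + intros Hab; clear IHb; simpl.
      induction c as [|c IHc|h IHh]; auto.
      * intros Hbc; exact (IHa _ _ Hab Hbc).
      * intros [n Hn]; exists n; exact (IHh n Hn).
    + intros [n Hn] Hg; exact (IHg n Hn (Hg n)).
  - intros H1 H2 n; exact (IHf n _ _ (H1 n) H2).
Qed.

Lemma ord_le_OS (a b : bord) : ord_le a b -> ord_le a (OS b).
Proof.
  revert b; induction a as [|a IHa|f IHf]; simpl; auto.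
  induction b as [|b IHb|g IHg]; intros H; [contradiction|auto|].
  destruct H as [n Hn]; apply ord_le_OL with n; auto.
Qed.

Fixpoint ord_add (a b : bord) : bord :=
  match b with
  | OZ => a
  | OS b' => OS (ord_add a b')
  | OL f => OL (fun n => ord_add a (f n))
  end.

Lemma ord_le_addr (a b : bord) : ord_le a (ord_add a b).
Proof.
  induction b as [|b IH|f IH]; simpl.
  - apply ord_le_refl.
  - apply ord_le_OS, IH.
  - apply ord_le_OL with 0%nat; auto.
Qed.

Lemma ord_le_addl (a b : bord) : ord_le b (ord_add a b).
Proof.
  induction b as [|b IH|f IH]; simpl; auto.
  intros n; apply (ord_le_OL _ (fun n => ord_add a (f n)) n); auto.
Qed.

Lemma ord_add_mono (a b c : bord) :
  ord_le b c -> ord_le (ord_add a b) (ord_add a c).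
Proof.
  revert c; induction b as [|b IHb|f IHf]; intros c.
  - intros _; apply ord_le_addr.
  - simpl. induction c as [|c IHc|g IHg]; [contradiction| |]; simpl; auto.
    intros [n Hn]; exists n; exact (IHg n Hn).
  - simpl; intros H n; auto.
Qed.

Lemma ord_wf_add (a b : bord) : ord_wf a -> ord_wf b -> ord_wf (ord_add a b).
Proof.
  intros Ha; induction b as [|b IH|f IH]; simpl; auto.
  intros H n; destruct (H n) as [H1 H2]; split; auto.
  exact (ord_add_mono a (OS (f n)) (f (S n)) H2).
Qed.

(** The partial sums [t 0 + (t 1 + 1) + ...] increase strictly because each new summand is a
    successor, so their limit is well formed; each sum dominates its last summand. *)
Lemma ord_wf_sup (t : nat -> bord) :
  (forall i, ord_wf (t i)) ->
  exists s, ord_wf s /\ forall i, ord_le (t i) s.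
Proof.
  intros Ht.
  set (u := fix u n := match n with
                       | 0%nat => t 0%nat
                       | S m => ord_add (u m) (OS (t (S m)))
                       end).
  assert (Hu : forall n, ord_wf (u n)).
  { induction n as [|n IH]; [apply Ht|].
    apply ord_wf_add; [exact IH|exact (Ht (S n))]. }
  exists (OL u); split.
  - intros n; split; [apply Hu|].
    exact (ord_le_addr (u n) (t (S n))).
  - intros i; apply ord_le_OL with i.
    destruct i as [|i]; [apply ord_le_refl|].
    apply ord_le_trans with (OS (t (S i))); [|apply ord_le_addl].
    exact (ord_le_addr (t (S i)) (OS OZ)).
Qed.

(** * Cofinal sets of countable ordinals and pigeonhole principles *)

Definition cofinal (A : bord -> Prop) : Prop :=
  forall t, ord_wf t -> exists s, A s /\ ord_le t s.

Lemma cofinal_inhabited (A : bord -> Prop) : cofinal A -> exists s, A s.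
Proof. intros H; destruct (H OZ I) as [s [Hs _]]; eauto. Qed.

Lemma cofinal_impl (A B : bord -> Prop) :
  (forall s, A s -> B s) -> cofinal A -> cofinal B.
Proof. intros H HA t Ht; destruct (HA t Ht) as [s [Hs Hle]]; eauto. Qed.

(** Regularity of omega_1: bounds for all the [B i] would have a countable supremum, which would
    bound their union. *)
Lemma cofinal_pigeonhole (B : nat -> bord -> Prop) :
  cofinal (fun s => exists i, B i s) -> exists i, cofinal (B i).
Proof.
  intros HA; apply NNPP; intros Hn.
  assert (H : forall i, exists t, ord_wf t /\ forall s, B i s -> ~ ord_le t s).
  { intros i; apply NNPP; intros Hi; apply Hn; exists i; intros t Ht.
    apply NNPP; intros Hs; apply Hi; exists t; split; auto.
    intros s HB Hle; apply Hs; eauto. }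
  apply functional_choice in H; destruct H as [t Ht].
  destruct (ord_wf_sup t) as [u [Hu Hle]]; [intros i; apply Ht|].
  destruct (HA u Hu) as [s [[i Hi] Hs]].
  apply (proj2 (Ht i) s Hi); eauto using ord_le_trans.
Qed.

(** Colours are fixed one index at a time. Every finite stage stays cofinal, whereas prescribing all
    of [c] at once could leave too few ordinals. *)
Lemma cofinal_nested_pigeonhole (A : bord -> Prop) (col : bord -> nat -> nat) :
  cofinal A -> exists c : nat -> nat, forall J,
    cofinal (fun s => A s /\ forall i, (i < J)%nat -> col s i = c i).
Proof.
  intros HA.
  set (B l s := A s /\ map (col s) (seq 0 (length l)) = l).
  (* Where [B l] is not cofinal, [0] is a dummy that keeps the choice function total. *)
  assert (step : forall l, exists v, cofinal (B l) -> cofinal (B (l ++ [v]))).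
  { intros l; destruct (classic (cofinal (B l))) as [Hl|Hl]; [|now exists 0%nat].
    destruct (cofinal_pigeonhole (fun v => B (l ++ [v]))) as [v Hv]; [|eauto].
    revert Hl; apply cofinal_impl; intros s [Hs Hm].
    exists (col s (length l)); split; auto.
    rewrite length_app, Nat.add_comm; simpl length.
    change (1 + length l)%nat with (S (length l)).
    rewrite seq_S, map_app, Hm; reflexivity. }
  apply functional_choice in step; destruct step as [next Hnext].
  set (pre := fix pre n := match n with
                           | 0%nat => []
                           | S m => pre m ++ [next (pre m)]
                           end).
  assert (Hpre : forall J, pre J = map (fun i => next (pre i)) (seq 0 J)).
  { induction J as [|J IH]; auto.
    rewrite seq_S, map_app, <- IH; reflexivity. }
  exists (fun i => next (pre i)); intros J.
  assert (HJ : cofinal (B (pre J))).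
  { induction J as [|J IH]; [|exact (Hnext _ IH)].
    revert HA; apply cofinal_impl; intros s Hs; split; auto. }
  revert HJ; apply cofinal_impl; intros s [Hs Hm]; split; auto.
  rewrite (Hpre J), length_map, length_seq in Hm.
  intros i Hi; exact (ext_in_map Hm i (proj2 (in_seq J 0 i) (conj (Nat.le_0_l i) Hi))).
Qed.

(** * Integer grids and codes of their labellings *)

Fixpoint list_code (l : list nat) : nat :=
  match l with
  | [] => 0
  | x :: l' => S (Cantor.to_nat (x, list_code l'))
  end.

Lemma list_code_inj (l l' : list nat) : list_code l = list_code l' -> l = l'.
Proof.
  revert l'; induction l as [|x l IH]; intros [|y l']; cbn [list_code]; try discriminate; auto.
  intros H; apply Nat.succ_inj in H.
  apply Cantor.to_nat_inj in H; injection H as -> H; f_equal; auto.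
Qed.

Definition grid (n k : nat) (x : nat -> Z) : Prop :=
  (forall i, (Z.abs (x i) <= Z.of_nat n)%Z) /\ forall i, (k <= i)%nat -> x i = 0%Z.

(** Finiteness of the grid lets a labelling of it be coded by one natural number, so a node of the
    tree has only countably many children. *)
Fixpoint grid_points (n k : nat) : list (nat -> Z) :=
  match k with
  | 0%nat => [fun _ => 0%Z]
  | S k' => flat_map (fun x => map (fun j i =>
       if Nat.eqb i k' then (Z.of_nat j - Z.of_nat n)%Z else x i)
       (seq 0 (2 * n + 1))) (grid_points n k')
  end.

Lemma grid_points_complete (n k : nat) (x : nat -> Z) :
  grid n k x -> In x (grid_points n k).
Proof.
  revert x; induction k as [|k IH]; intros x [Hb H0].
  - left; apply functional_extensionality; intros i; symmetry; apply H0; lia.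
  - cbn [grid_points]. apply in_flat_map.
    exists (fun i => if Nat.eqb i k then 0%Z else x i); split.
    + apply IH; split; intros i; destruct (Nat.eqb_spec i k); try lia; auto.
      intros Hi; apply H0; lia.
    + apply in_map_iff; exists (Z.to_nat (x k + Z.of_nat n)); split.
      * apply functional_extensionality; intros i.
        specialize (Hb k); destruct (Nat.eqb_spec i k); subst; lia.
      * apply in_seq; specialize (Hb k); lia.
Qed.

Lemma grid_le (n k k' : nat) (x : nat -> Z) :
  (k <= k')%nat -> grid n k x -> grid n k' x.
Proof. intros Hk [H1 H2]; split; auto; intros i Hi; apply H2; lia. Qed.

(** * Rank and infinite branches in the tree of partial embeddings *)

(** A node of level [k] is a labelling of [grid n k], represented by any total function with these
    values; functions that agree represent the same node. *)
Definition agree (n k : nat) (g g' : (nat -> Z) -> nat) : Prop :=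
  forall x, grid n k x -> g x = g' x.

(* [g] restricted to the first [k] coordinates is a node of the tree of partial
   embeddings whose rank is at least [a]. *)
Fixpoint deep (n : nat) (ok : nat -> ((nat -> Z) -> nat) -> Prop)
  (a : bord) (g : (nat -> Z) -> nat) (k : nat) : Prop :=
  match a with
  | OZ => ok k g
  | OS a' => exists g', agree n k g g' /\ deep n ok a' g' (S k)
  | OL f => forall m, deep n ok (f m) g k
  end.

(** For [k < k'] this makes the admissible nodes a tree; for [k = k'] it says that admissibility
    depends on the node only. *)
Definition restrictable (n : nat) (ok : nat -> ((nat -> Z) -> nat) -> Prop) : Prop :=
  forall k k' g g', (k <= k')%nat -> agree n k g g' -> ok k' g' -> ok k g.

Section Deep.

Variables (n : nat) (ok : nat -> ((nat -> Z) -> nat) -> Prop).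
Hypothesis Hok : restrictable n ok.

Lemma deep_ok (a : bord) (g : (nat -> Z) -> nat) (k : nat) :
  deep n ok a g k -> ok k g.
Proof.
  revert g k; induction a as [|a IH|f IH]; simpl; intros g k; auto.
  - intros [g' [Hg Hd]]; apply (Hok k (S k) g g'); auto.
  - intros H; exact (IH 0%nat g k (H 0%nat)).
Qed.

Lemma deep_agree (a : bord) (g g' : (nat -> Z) -> nat) (k : nat) :
  agree n k g g' -> deep n ok a g k -> deep n ok a g' k.
Proof.
  revert g g' k; induction a as [|a IH|f IH]; simpl; intros g g' k Hg.
  - apply (Hok k k); auto. intros x Hx; symmetry; auto.
  - intros [h [Hh Hd]]; exists h; split; auto.
    intros x Hx; rewrite <- Hg; auto.
  - intros H m; eauto.
Qed.

Lemma deep_le (a b : bord) (g : (nat -> Z) -> nat) (k : nat) :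
  ord_le a b -> deep n ok b g k -> deep n ok a g k.
Proof.
  revert b g k; induction a as [|a IHa|f IHf]; intros b g k.
  - intros _; apply deep_ok.
  - simpl; induction b as [|b IHb|h IHh]; simpl; [contradiction| |].
    + intros Hab [g' [Hg Hd]]; exists g'; split; eauto.
    + intros [m Hm] Hd; exact (IHh m Hm (Hd m)).
  - simpl; intros H Hd m; eauto.
Qed.

(** Rank at least [OS t] gives a child of rank at least [t]. Children have countably many codes, so
    by pigeonhole one child keeps cofinally many ranks. *)
Lemma deep_step (k : nat) (g : (nat -> Z) -> nat) :
  cofinal (fun a => deep n ok a g k) ->
  exists g', agree n k g g' /\ cofinal (fun a => deep n ok a g' (S k)).
Proof.
  intros Hg.
  set (code g' := list_code (map g' (grid_points n (S k)))).
  destruct (cofinal_pigeonhole (fun c a => exists g',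
    code g' = c /\ agree n k g g' /\ deep n ok a g' (S k))) as [c Hc].
  { intros t Ht; destruct (Hg (OS t) Ht) as [s [Hs Hle]].
    destruct (deep_le _ _ _ _ Hle Hs) as [g' [Hag Hd]].
    exists t; split; [|apply ord_le_refl].
    exists (code g'), g'; auto. }
  destruct (cofinal_inhabited _ Hc) as [_ [g' [Hcode [Hag _]]]].
  exists g'; split; auto.
  revert Hc; apply cofinal_impl; intros s [g'' [Hcode' [_ Hd]]].
  apply (deep_agree s g''); auto.
  intros x Hx; apply grid_points_complete in Hx.
  rewrite <- Hcode in Hcode'; apply list_code_inj in Hcode'.
  exact (ext_in_map Hcode' x Hx).
Qed.

Lemma deep_branch (g : (nat -> Z) -> nat) :
  cofinal (fun a => deep n ok a g 0) ->
  exists G, agree n 0 g G /\ forall k, ok k G.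
Proof.
  intros H0.
  assert (step : forall kg, exists g', 
    cofinal (fun a => deep n ok a (snd kg) (fst kg)) ->
    agree n (fst kg) (snd kg) g' /\
    cofinal (fun a => deep n ok a g' (S (fst kg)))).
  { intros [k h]; simpl.
    destruct (classic (cofinal (fun a => deep n ok a h k))) as [H|H].
    - destruct (deep_step k h H) as [g' Hg']; exists g'; auto.
    - exists h; contradiction. }
  apply functional_choice in step; destruct step as [next Hnext].
  set (br := fix br k := match k with
                         | 0%nat => g
                         | S m => next (m, br m)
                         end).
  assert (Hbr : forall k, cofinal (fun a => deep n ok a (br k) k)).
  { induction k as [|k IH]; auto. exact (proj2 (Hnext (k, br k) IH)). }
  assert (Hag : forall k m, agree n k (br k) (br (k + m)%nat)).
  { intros k m; induction m as [|m IH]; intros x Hx.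
    - now rewrite Nat.add_0_r.
    - rewrite (IH x Hx), Nat.add_succ_r.
      apply (proj1 (Hnext ((k + m)%nat, br (k + m)%nat) (Hbr _))).
      apply grid_le with k; simpl; auto; lia. }
  (* The chosen nodes extend one another, so all levels containing [x] give it the same label; [0]
     is a dummy for [x] in no grid. *)
  assert (HG : forall x, exists v, forall k, grid n k x -> br k x = v).
  { intros x; destruct (classic (exists k, grid n k x)) as [[k Hk]|Hno].
    - exists (br k x); intros k' Hk'.
      rewrite (Hag k k' x Hk), (Hag k' k x Hk'), Nat.add_comm; auto.
    - exists 0%nat; intros k Hk; exfalso; eauto. }
  apply functional_choice in HG; destruct HG as [G HG].
  exists G; split; [exact (fun x => HG x 0%nat)|].
  intros k; apply (Hok k k _ (br k)); auto.
  - intros x Hx; symmetry; auto.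
  - destruct (cofinal_inhabited _ (Hbr k)) as [a Ha]; exact (deep_ok a _ _ Ha).
Qed.

End Deep.

(** * Placing coordinates on a Schreier set *)

Fixpoint spread (G : list nat) (x : nat -> Z) (i : nat) : Z :=
  match G with
  | [] => 0
  | m :: G' => if Nat.eqb i m then x 0%nat else spread G' (fun j => x (S j)) i
  end.

Lemma spread_notin (G : list nat) (x : nat -> Z) (i : nat) :
  ~ In i G -> spread G x i = 0%Z.
Proof.
  revert x; induction G as [|m G IH]; intros x Hi; simpl; auto.
  destruct (Nat.eqb_spec i m) as [->|Hne].
  - exfalso; apply Hi; left; auto.
  - apply IH; intros H; apply Hi; right; auto.
Qed.

Lemma spread_nth (G : list nat) (x : nat -> Z) (j : nat) :
  NoDup G -> (j < length G)%nat -> spread G x (nth j G 0%nat) = x j.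
Proof.
  revert x j; induction G as [|m G IH]; intros x j HG Hj; simpl in *; [lia|].
  inversion_clear HG as [|? ? Hm HG'].
  destruct j as [|j]; [now rewrite Nat.eqb_refl|].
  destruct (Nat.eqb_spec (nth j G 0%nat) m) as [<-|Hne].
  - exfalso; apply Hm, nth_In; lia.
  - apply (IH (fun j => x (S j))); auto; lia.
Qed.

(** Appending a point to [G] keeps the labels [h (spread G x)] of the old vectors, so the longer set
    gives a child of the node given by [G]. *)
Lemma spread_rcons (G : list nat) (m : nat) (x : nat -> Z) :
  x (length G) = 0%Z -> spread (G ++ [m]) x = spread G x.
Proof.
  intros Hx; apply functional_extensionality; intros i.
  revert x Hx; induction G as [|p G IH]; intros x Hx; simpl in *.
  - now destruct (Nat.eqb i m).
  - rewrite IH; auto.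
Qed.

Lemma spread_dist_le (G : list nat) (x y : nat -> Z) (j : Z) :
  (0 <= j)%Z -> (forall i, (Z.abs (x i - y i) <= j)%Z) ->
  forall i, (Z.abs (spread G x i - spread G y i) <= j)%Z.
Proof.
  intros Hj; revert x y; induction G as [|p G IH]; intros x y H i; simpl; auto.
  destruct (Nat.eqb i p); auto.
Qed.

Lemma schreier_singleton (a : bord) (m : nat) : (0 < m)%nat -> schreier a [m].
Proof.
  intros Hm; induction a as [|a IH|f IH]; simpl.
  - eauto.
  - exists [[m]]; simpl; repeat split; auto.
  - exists 0%nat; split; [lia|auto].
Qed.

Lemma Sorted_lt_rcons (G : list nat) (m : nat) :
  Sorted lt G -> (list_max G < m)%nat -> Sorted lt (G ++ [m]).
Proof.
  induction G as [|p G IH]; intros HG Hm; simpl in *.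
  - repeat constructor.
  - inversion_clear HG as [|? ? HG' Hp]; constructor.
    + apply IH; auto; lia.
    + destruct G as [|q G]; constructor; [lia|].
      inversion_clear Hp; auto.
Qed.

Lemma Sorted_app_r (G B : list nat) : Sorted lt (G ++ B) -> Sorted lt B.
Proof.
  induction G as [|p G IH]; simpl; auto.
  intros H; inversion_clear H; auto.
Qed.

(* Prefixing one point [m >= 2] to a set of S_a gives a set of S_{a+1}, because
   singletons belong to every S_a: this one point per successor step is
   what makes S_a extendable [a] times. *)
Lemma schreier_deep (n : nat) (ok : nat -> ((nat -> Z) -> nat) -> Prop)
  (Hok : restrictable n ok) (h : (nat -> Z) -> nat) (a : bord) :
  forall (low : nat) (G : list nat), Sorted lt G ->
  (forall B, schreier a B -> (low <= hd 0%nat B)%nat -> Sorted lt (G ++ B) ->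
     ok (length (G ++ B)) (fun x => h (spread (G ++ B) x))) ->
  deep n ok a (fun x => h (spread G x)) (length G).
Proof.
  assert (Hag : forall G m, agree n (length G)
    (fun x => h (spread G x)) (fun x => h (spread (G ++ [m]) x))).
  { intros G m x [_ Hx]; rewrite spread_rcons; auto. }
  induction a as [|a IH|f IH]; intros low G HG H.
  - set (m := S (low + list_max G)).
    apply (Hok _ (length (G ++ [m]))) with (2 := Hag G m); [rewrite last_length; lia|].
    apply H; simpl; [exists m; split; auto; unfold m; lia|unfold m; lia|].
    apply Sorted_lt_rcons; auto; unfold m; lia.
  (* At least 2, so that the two sets [[m]] and [B] may be united; above [low], so that [B] inherits
     no bound of its own. *)
  - set (m := (2 + low + list_max G)%nat).
    assert (HG' : Sorted lt (G ++ [m])).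
    { apply Sorted_lt_rcons; auto; unfold m; lia. }
    exists (fun x => h (spread (G ++ [m]) x)); split; [apply Hag|].
    rewrite <- (last_length G m).
    apply (IH 0%nat); auto.
    intros B HB _; rewrite <- app_assoc; intros HS; apply H; auto.
    + exists [[m]; B]; simpl; rewrite app_nil_r; repeat split; auto.
      * unfold m; lia.
      * repeat constructor; auto. apply schreier_singleton; unfold m; lia.
      * exact (Sorted_app_r G _ HS).
    + simpl; unfold m; lia.
  (* Raising the bound by [S p] meets the condition on the minimum in the limit case. *)
  - simpl; intros p; apply (IH p (low + S p)%nat); auto.
    intros B HB Hlow HS; apply H; auto; [|lia].
    exists p; split; auto; lia.
Qed.

(** * The sup norm of bounded sequences *)

(** The bound excludes the supremum [p_infty], which [real] would send to 0. *)
Lemma supnorm_is_lub (x : nat -> R) :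
  (exists K, forall i, Rabs (x i) <= K) ->
  is_lub_Rbar (fun r => exists i, r = Rabs (x i)) (Finite (supnorm x)).
Proof.
  intros [K HK]; unfold supnorm.
  generalize (Lub_Rbar_correct (fun r => exists i, r = Rabs (x i))).
  destruct (Lub_Rbar _) as [l| |]; auto; intros [Hub Hlub]; exfalso.
  - apply (Hlub (Finite K)); intros r [i ->]; apply HK.
  - exact (Hub (Rabs (x 0%nat)) (ex_intro _ 0%nat eq_refl)).
Qed.

Lemma supnorm_ub (x : nat -> R) (i : nat) :
  (exists K, forall j, Rabs (x j) <= K) -> Rabs (x i) <= supnorm x.
Proof. intros Hb; apply (proj1 (supnorm_is_lub x Hb)); eauto. Qed.

Lemma supnorm_le (x : nat -> R) (K : R) :
  (forall i, Rabs (x i) <= K) -> supnorm x <= K.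
Proof.
  intros HK; apply (proj2 (supnorm_is_lub x (ex_intro _ K HK)) (Finite K)).
  intros r [i ->]; apply HK.
Qed.

Lemma supnorm_pos (x : nat -> R) :
  (exists K, forall i, Rabs (x i) <= K) -> 0 <= supnorm x.
Proof.
  intros Hb; apply Rle_trans with (Rabs (x 0%nat)); [apply Rabs_pos|].
  now apply supnorm_ub.
Qed.

Lemma supnorm_approx (x : nat -> R) (r : R) :
  (exists K, forall i, Rabs (x i) <= K) -> r < supnorm x ->
  exists i, r < Rabs (x i).
Proof.
  intros Hb Hr; apply NNPP; intros Hn; apply (Rlt_not_le _ _ Hr), supnorm_le.
  intros i; apply Rnot_lt_le; eauto.
Qed.

Lemma c0_bounded (x : nat -> R) : c0 x -> exists K, forall i, Rabs (x i) <= K.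
Proof.
  intros H; destruct (filterlim_bounded x (ex_intro _ 0 H)) as [K HK].
  exists K; exact HK.
Qed.

(** * Gauges built from integer sequences *)

Definition natfloor (t : R) : nat := Z.to_nat (Int_part t).

Lemma natfloor_bounds (t : R) :
  0 <= t -> INR (natfloor t) <= t < INR (natfloor t) + 1.
Proof.
  intros Ht; unfold natfloor; destruct (base_Int_part t) as [H1 H2].
  assert (H : (-1 < Int_part t)%Z) by (apply lt_IZR; simpl; lra).
  rewrite INR_IZR_INZ, Z2Nat.id by lia; lra.
Qed.

Lemma natfloor_le (s t : R) : 0 <= s -> s <= t -> (natfloor s <= natfloor t)%nat.
Proof.
  intros Hs Ht; apply Nat.lt_succ_r, INR_lt; rewrite S_INR.
  generalize (natfloor_bounds s Hs) (natfloor_bounds t ltac:(lra)); lra.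
Qed.

Lemma natfloor_ge (m : nat) (t : R) : INR m <= t -> (m <= natfloor t)%nat.
Proof.
  intros Hm; apply Nat.lt_succ_r, INR_lt; rewrite S_INR.
  generalize (pos_INR m) (natfloor_bounds t); lra.
Qed.

Fixpoint max_upto (q : nat -> nat) (m : nat) : nat :=
  match m with
  | 0%nat => q 0%nat
  | S m' => Nat.max (max_upto q m') (q m)
  end.

Lemma max_upto_ge (q : nat -> nat) (i m : nat) :
  (i <= m)%nat -> (q i <= max_upto q m)%nat.
Proof.
  induction m as [|m IH]; intros Hi; simpl.
  - replace i with 0%nat by lia; auto.
  - destruct (Nat.eq_dec i (S m)) as [->|Hne]; [lia|].
    specialize (IH ltac:(lia)); lia.
Qed.

Lemma max_upto_attained (q : nat -> nat) (m : nat) :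
  exists i, (i <= m)%nat /\ max_upto q m = q i.
Proof.
  induction m as [|m [i [Hi Hq]]]; simpl; [eauto|].
  destruct (Nat.max_spec (max_upto q m) (q (S m))) as [[_ ->]|[_ ->]]; eauto.
Qed.

Lemma max_upto_le (q : nat -> nat) (m m' : nat) :
  (m <= m')%nat -> (max_upto q m <= max_upto q m')%nat.
Proof.
  intros Hm; destruct (max_upto_attained q m) as [i [Hi ->]].
  apply max_upto_ge; lia.
Qed.

(** A generalized inverse of [T]: the largest [j <= m] with [T j <= m], or 0 if there is none. *)
Definition lower_gauge (T : nat -> nat) (m : nat) : nat :=
  max_upto (fun j => if (T j <=? m)%nat then j else 0%nat) m.

Lemma lower_gauge_le (T : nat -> nat) (m m' : nat) :
  (m <= m')%nat -> (lower_gauge T m <= lower_gauge T m')%nat.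
Proof.
  intros Hm; unfold lower_gauge at 1.
  destruct (max_upto_attained (fun j => if (T j <=? m)%nat then j else 0%nat) m)
    as [i [Hi ->]].
  destruct (Nat.leb_spec (T i) m) as [HT|_]; [|lia].
  apply Nat.le_trans with (if (T i <=? m')%nat then i else 0%nat).
  - destruct (Nat.leb_spec (T i) m'); lia.
  - apply (max_upto_ge (fun j => if (T j <=? m')%nat then j else 0%nat)); lia.
Qed.

Lemma lower_gauge_attained (T : nat -> nat) (m : nat) :
  lower_gauge T m = 0%nat \/ (T (lower_gauge T m) <= m)%nat.
Proof.
  unfold lower_gauge.
  destruct (max_upto_attained (fun j => if (T j <=? m)%nat then j else 0%nat) m)
    as [i [_ ->]].
  destruct (Nat.leb_spec (T i) m) as [HT|_]; auto.
Qed.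

Lemma lower_gauge_ge (T : nat -> nat) (j m : nat) :
  (j <= T j <= m)%nat -> (j <= lower_gauge T m)%nat.
Proof.
  intros Hj; unfold lower_gauge.
  apply Nat.le_trans with (if (T j <=? m)%nat then j else 0%nat).
  - destruct (Nat.leb_spec (T j) m); lia.
  - apply (max_upto_ge (fun j => if (T j <=? m)%nat then j else 0%nat)); lia.
Qed.

(** The shifts by one leave room for rounding. Since [j <= T j], any [m >= T j] has [j] in the
    search range of [lower_gauge], whence the limit at infinity. *)
Lemma gauges_of_sequences (T L : nat -> nat) :
  (forall j, (j <= T j)%nat) ->
  gauges (fun t => INR (lower_gauge T (natfloor t - 1)))
         (fun t => INR (max_upto L (natfloor t + 1))).
Proof.
  intros HT; split; [|split].
  - intros s t Hs Hst; generalize (natfloor_le s t Hs Hst); intros H.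
    split; apply le_INR; [apply lower_gauge_le|apply max_upto_le]; lia.
  - intros t _; split; apply pos_INR.
  - intros K; destruct (INR_unbounded K) as [j Hj].
    exists (INR (T j + 1)); intros t Ht; apply natfloor_ge in Ht.
    apply Rle_trans with (INR j); [lra|].
    apply le_INR, lower_gauge_ge; specialize (HT j); lia.
Qed.

Lemma gauges_comp (rho omega : R -> R) (c : R) : 0 < c ->
  gauges rho omega ->
  gauges (fun t => rho (Rmax 0 ((t - c) / c))) omega.
Proof.
  intros Hc [Hmono [Hpos Hlim]]; split; [|split].
  - intros s t Hs Hst; split; [|now apply Hmono].
    apply Hmono; [apply Rmax_l|].
    apply Rle_max_compat_l, Rmult_le_compat_r; [|lra].
    apply Rlt_le, Rinv_0_lt_compat, Hc.
  - intros t Ht; split; apply Hpos; [apply Rmax_l|exact Ht].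
  - intros K; destruct (Hlim K) as [T HT]; exists (c * T + c); intros t Ht.
    apply HT; apply Rle_trans with ((t - c) / c); [|apply Rmax_r].
    apply Rmult_le_reg_r with c; auto. field_simplify; lra.
Qed.

(** * Uniform integer gauges and embedded grids *)

Lemma dense_sequence (X : Type) (dX : X -> X -> R) (x0 : X) :
  separable dX -> exists D : nat -> X, forall x, exists k, dX x (D k) < 1.
Proof.
  intros [s Hs].
  exists (fun k => match s k with Some y => y | None => x0 end); intros x.
  destruct (Hs x 1 Rlt_0_1) as [k [y [Hk Hy]]].
  exists k; now rewrite Hk.
Qed.

(* [r] plays the role of the distance of the images of [x] and [y]: the first
   [J] values of the gauges, read at integer distances. *)
Definition profile (T L : nat -> nat) (J : nat) (x y : nat -> Z) (r : R) : Prop :=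
  forall j, (j < J)%nat ->
    ((forall i, (Z.abs (x i - y i) <= Z.of_nat j)%Z) -> r <= INR (L j)) /\
    ((exists i, (Z.of_nat (T j) <= Z.abs (x i - y i))%Z) -> INR j <= r).

Lemma profile_spread (T L : nat -> nat) (J : nat) (G : list nat)
  (x y : nat -> Z) (r : R) :
  NoDup G -> (forall i, (length G <= i)%nat -> x i = 0%Z /\ y i = 0%Z) ->
  profile T L J (spread G x) (spread G y) r -> profile T L J x y r.
Proof.
  intros HG H0 H j Hj; destruct (H j Hj) as [Hup Hlow]; split.
  - intros Hxy; apply Hup, spread_dist_le; [lia|exact Hxy].
  - intros [i Hi]; apply Hlow.
    destruct (Nat.lt_ge_cases i (length G)) as [Hlt|Hge].
    + exists (nth i G 0%nat); now rewrite !spread_nth.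
    (* Both entries vanish, which forces [T j = 0]; then any index is a witness. *)
    + destruct (H0 i Hge) as [Hx Hy]; rewrite Hx, Hy in Hi.
      exists 0%nat; simpl in Hi; lia.
Qed.

(** Spreading over Schreier sets of order [a] gives the root rank at least [a]; an infinite branch
    is then one labelling good on the grids of all dimensions. *)
Lemma grid_embedding (M : Type) (d : M -> M -> R) (D : nat -> M) (c n : nat)
  (T L : nat -> nat) (J : nat) :
  cofinal (fun a => exists h : (nat -> Z) -> nat, h (fun _ => 0%Z) = c /\
    forall x y, schreierZ a x -> schreierZ a y ->
      profile T L J x y (d (D (h x)) (D (h y)))) ->
  exists G : (nat -> Z) -> nat, G (fun _ => 0%Z) = c /\
    forall k x y, grid n k x -> grid n k y ->
      profile T L J x y (d (D (G x)) (D (G y))).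
Proof.
  intros Hcof.
  set (ok k (g : (nat -> Z) -> nat) := forall x y, grid n k x -> grid n k y ->
    profile T L J x y (d (D (g x)) (D (g y)))).
  assert (Hok : restrictable n ok).
  { intros k k' g g' Hk Hg Hg' x y Hx Hy; rewrite (Hg x Hx), (Hg y Hy).
    apply Hg'; apply grid_le with k; auto. }
  (* The level 0 grid is the zero vector alone, so the common value [c] there gives all the maps [h]
     the same root. *)
  destruct (deep_branch n ok Hok (fun _ => c)) as [G [HG0 HG]].
  - revert Hcof; apply cofinal_impl; intros a [h [Hh Hprof]].
    apply (deep_agree n ok Hok a (fun x => h (spread [] x))).
    + intros x _; exact Hh.
    + apply (schreier_deep n ok Hok h a 0%nat []); [constructor|].
      simpl; intros B HB _ HS x y Hx Hy.
      apply profile_spread with B.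
      * apply Sorted_StronglySorted in HS; [|exact Nat.lt_trans].
        clear - HS; induction HS as [|p B HS IH Hp]; constructor; auto.
        intros Hin; rewrite Forall_forall in Hp; specialize (Hp _ Hin); lia.
      * intros i Hi; split; [apply Hx|apply Hy]; auto.
      * apply Hprof; exists B; split; auto; intros i; apply spread_notin.
  - exists G; split; auto.
    symmetry; apply HG0; split; simpl; intros; auto; lia.
Qed.

(** Each embedding becomes a sequence of naturals, ready for the nested pigeonhole: entry 0 is the
    index of the image of 0, entry [S j] encodes the pair of [T j] and [L j]. *)
Lemma uniform_profile (M : Type) (d : M -> M -> R) (D : nat -> M)
  (A : bord -> Prop) :
  is_metric d -> (forall p, exists k, d p (D k) < 1) -> cofinal A ->
  (forall a, A a -> coarse_embeds (schreierZ a) dinfZ d) ->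
  exists (c : nat) (T L : nat -> nat), (forall j, (j <= T j)%nat) /\
    forall J, cofinal (fun a => exists h : (nat -> Z) -> nat,
      h (fun _ => 0%Z) = c /\
      forall x y, schreierZ a x -> schreierZ a y ->
        profile T L J x y (d (D (h x)) (D (h y)))).
Proof.
  intros [_ [_ [_ [Hsym Htri]]]] HD HA Hemb.
  set (encodes a (col : nat -> nat) := exists h : (nat -> Z) -> nat,
    h (fun _ => 0%Z) = col 0%nat /\
    forall j, let (Tj, Lj) := Cantor.of_nat (col (S j)) in (j <= Tj)%nat /\
      forall x y, schreierZ a x -> schreierZ a y ->
      ((forall i, (Z.abs (x i - y i) <= Z.of_nat j)%Z) ->
         d (D (h x)) (D (h y)) <= INR Lj) /\
      ((exists i, (Z.of_nat Tj <= Z.abs (x i - y i))%Z) ->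
         INR j <= d (D (h x)) (D (h y)))).
  assert (HR : forall a, exists col, A a -> encodes a col).
  { intros a; destruct (classic (A a)) as [Ha|Ha]; [|exists (fun _ => 0%nat); tauto].
    destruct (Hemb a Ha) as [f [rho [omega [[Hmono [_ Hlim]] Hf]]]].
    destruct (functional_choice _ HD) as [near Hnear].
    set (h x := near (f x)).
    (* Each of the two images moves by less than 1. *)
    assert (Hh : forall x y, Rabs (d (D (h x)) (D (h y)) - d (f x) (f y)) <= 2).
    { intros x y; generalize (Hnear (f x)) (Hnear (f y)).
      generalize (Htri (D (h x)) (f x) (D (h y))) (Htri (f x) (f y) (D (h y))).
      generalize (Htri (f x) (D (h x)) (f y)) (Htri (D (h x)) (D (h y)) (f y)).
      rewrite (Hsym (D (h x)) (f x)), (Hsym (D (h y)) (f y)).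
      fold (h x) (h y); intros; apply Rabs_le; lra. }
    assert (Hj : forall j, exists TL : nat * nat, (j <= fst TL)%nat /\
      forall x y, schreierZ a x -> schreierZ a y ->
      ((forall i, (Z.abs (x i - y i) <= Z.of_nat j)%Z) ->
         d (D (h x)) (D (h y)) <= INR (snd TL)) /\
      ((exists i, (Z.of_nat (fst TL) <= Z.abs (x i - y i))%Z) ->
         INR j <= d (D (h x)) (D (h y)))).
    { intros j.
      (* The 2 absorbs the move into the dense set; adding [j] to [T1] ensures [j <= T j]. *)
      destruct (Hlim (INR j + 2)) as [T0 HT0].
      destruct (INR_unbounded T0) as [T1 HT1].
      destruct (INR_unbounded (omega (INR j) + 2)) as [L1 HL1].
      exists ((T1 + j)%nat, L1); simpl; split; [lia|].
      intros x y Hx Hy.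
      assert (Hb : exists K, forall i, Rabs (IZR (x i - y i)) <= K).
      { apply (c0_bounded (fun i => IZR (x i - y i))).
        destruct Hx as [G [_ HG]], Hy as [G' [_ HG']].
        apply is_lim_seq_ext_loc with (fun _ => 0); [|apply is_lim_seq_const].
        exists (S (list_max (G ++ G'))); intros i Hi.
        assert (Hn : ~ In i (G ++ G')).
        { intros Hin.
          assert (Hm := proj1 (list_max_le (G ++ G') _) (Nat.le_refl _)).
          rewrite Forall_forall in Hm; specialize (Hm _ Hin); lia. }
        rewrite in_app_iff in Hn; rewrite HG, HG'; auto. }
      specialize (Hh x y); apply Rabs_le_between in Hh.
      destruct (Hf x y Hx Hy) as [Hlo Hup].
      assert (Hpos : 0 <= dinfZ x y) by now apply supnorm_pos.
      split.
      - intros Hi.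
        assert (Hd : dinfZ x y <= INR j).
        { apply supnorm_le; intros i; rewrite <- abs_IZR, INR_IZR_INZ.
          apply IZR_le; auto. }
        generalize (proj2 (Hmono _ _ Hpos Hd)); lra.
      - intros [i Hi].
        assert (Hd : INR (T1 + j) <= dinfZ x y).
        { apply Rle_trans with (Rabs (IZR (x i - y i))).
          - rewrite <- abs_IZR, INR_IZR_INZ; apply IZR_le; auto.
          - now apply (supnorm_ub (fun i => IZR (x i - y i))). }
        rewrite plus_INR in Hd; generalize (pos_INR j) (HT0 (dinfZ x y)); lra. }
    destruct (functional_choice _ Hj) as [TL HTL].
    exists (fun i => match i with
                     | 0%nat => h (fun _ => 0%Z)
                     | S j => Cantor.to_nat (TL j)
                     end).
    intros _; exists h; split; auto.
    intros j; rewrite Cantor.cancel_of_to.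
    specialize (HTL j); destruct (TL j) as [Tj Lj]; exact HTL. }
  destruct (functional_choice _ HR) as [col Hcol].
  destruct (cofinal_nested_pigeonhole A col HA) as [c Hc].
  exists (c 0%nat), (fun j => fst (Cantor.of_nat (c (S j)))),
    (fun j => snd (Cantor.of_nat (c (S j)))); split.
  - intros j; destruct (cofinal_inhabited _ (Hc (S (S j)))) as [a [Ha Hac]].
    destruct (Hcol a Ha) as [h [_ Hh]]; specialize (Hh j).
    rewrite Hac in Hh by lia; destruct (Cantor.of_nat _); apply Hh.
  (* One stage more than [J], since entry 0 holds the image of 0. *)
  - intros J; generalize (Hc (S J)); apply cofinal_impl; intros a [Ha Hac].
    destruct (Hcol a Ha) as [h [Hh0 Hh]]; exists h; split.
    + rewrite Hh0; apply Hac; lia.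
    + intros x y Hx Hy j Hj; specialize (Hh j).
      rewrite Hac in Hh by lia; destruct (Cantor.of_nat _); apply Hh; auto.
Qed.

(** * Rounding from the ball of c_0 to the grid *)

Definition round (t : R) : Z := Int_part (t + / 2).

Lemma round_bounds (t : R) : t - / 2 < IZR (round t) <= t + / 2.
Proof. unfold round; destruct (base_Int_part (t + / 2)); lra. Qed.

Lemma round_grid (n : nat) (x : nat -> R) :
  c0 x -> supnorm x <= INR n -> exists k, grid n k (fun i => round (x i)).
Proof.
  intros Hx Hn.
  destruct (proj1 (is_lim_seq_Reals _ _) Hx (/ 2) ltac:(lra)) as [k Hk].
  exists k; split.
  - intros i.
    assert (Hi : Rabs (x i) <= INR n).
    { apply Rle_trans with (2 := Hn), supnorm_ub, c0_bounded, Hx. }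
    apply Rabs_le_between in Hi; rewrite INR_IZR_INZ in Hi.
    destruct (round_bounds (x i)) as [H1 H2].
    assert (round (x i) < Z.of_nat n + 1)%Z.
    { apply lt_IZR; rewrite plus_IZR; lra. }
    assert (- Z.of_nat n - 1 < round (x i))%Z.
    { apply lt_IZR; rewrite minus_IZR, opp_IZR; lra. }
    lia.
  - intros i Hi; specialize (Hk i Hi); unfold Rdist in Hk.
    rewrite Rminus_0_r in Hk; apply Rabs_lt_between in Hk.
    destruct (round_bounds (x i)) as [H1 H2].
    assert (round (x i) < 1)%Z by (apply lt_IZR; lra).
    assert (-1 < round (x i))%Z by (apply lt_IZR; lra).
    lia.
Qed.

Lemma round_zero : round 0 = 0%Z.
Proof.
  destruct (round_bounds 0) as [H1 H2].
  assert (round 0 < 1)%Z by (apply lt_IZR; lra).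
  assert (-1 < round 0)%Z by (apply lt_IZR; lra).
  lia.
Qed.

(** Rounding changes coordinate differences by less than 1. Grid points of radius [n] are at most
    [2 * n] apart, so the first [2 * n + 1] gauge values suffice. *)
Lemma profile_round (T L : nat -> nat) (n : nat) (x y : nat -> R) (r : R) :
  (forall j, (j <= T j)%nat) -> 0 <= r ->
  c0 x -> supnorm x <= INR n -> c0 y -> supnorm y <= INR n ->
  profile T L (2 * n + 1) (fun i => round (x i)) (fun i => round (y i)) r ->
  let t := supnorm (fun i => x i - y i) in
  INR (lower_gauge T (natfloor t - 1)) <= r <= INR (max_upto L (natfloor t + 1)).
Proof.
  intros HT Hr Hx Hxn Hy Hyn H t.
  assert (Hb : exists K, forall i, Rabs (x i - y i) <= K).
  { apply (c0_bounded (fun i => x i - y i)); unfold c0.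
    replace 0 with (0 - 0) by ring; now apply is_lim_seq_minus'. }
  destruct (natfloor_bounds t (supnorm_pos _ Hb)) as [Ht1 Ht2].
  destruct (round_grid n x Hx Hxn) as [kx [Hgx _]].
  destruct (round_grid n y Hy Hyn) as [ky [Hgy _]].
  set (m := natfloor t) in *; split.
  - destruct (lower_gauge_attained T (m - 1)) as [->|Hj]; [exact Hr|].
    set (j := lower_gauge T (m - 1)) in *.
    destruct (Nat.eq_dec j 0) as [->|Hj0]; [exact Hr|].
    specialize (HT j).
    (* With slack 1/2 some coordinate exceeds [m - 1/2]; after rounding, its integer difference
       exceeds [m - 3/2], so it is at least [m - 1]. *)
    assert (Hlt : INR m - / 2 < t) by lra.
    destruct (supnorm_approx _ _ Hb Hlt) as [i Hi].
    assert (Hi' : (Z.of_nat m - 2 < Z.abs (round (x i) - round (y i)))%Z).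
    { apply lt_IZR; rewrite minus_IZR, abs_IZR, minus_IZR, <- INR_IZR_INZ.
      destruct (round_bounds (x i)), (round_bounds (y i)).
      revert Hi; unfold Rabs; do 2 destruct Rcase_abs; lra. }
    apply H; [specialize (Hgx i); specialize (Hgy i); lia|].
    exists i; lia.
  - assert (Hi : forall i, (Z.abs (round (x i) - round (y i)) < Z.of_nat m + 2)%Z).
    { intros i; assert (Hi := supnorm_ub _ i Hb); fold t in Hi; cbv beta in Hi.
      apply lt_IZR; rewrite plus_IZR, abs_IZR, minus_IZR, <- INR_IZR_INZ.
      destruct (round_bounds (x i)), (round_bounds (y i)).
      revert Hi; unfold Rabs; do 2 destruct Rcase_abs; lra. }
    apply Rle_trans with (INR (L (Nat.min (m + 1) (2 * n)))).
    + apply H; [lia|]; intros i.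
      specialize (Hi i); specialize (Hgx i); specialize (Hgy i); lia.
    + apply le_INR, max_upto_ge; lia.
Qed.

(** * An Aharoni-type map for bounded separable spaces *)

Section Aharoni.

Variables (X : Type) (dX : X -> X -> R) (D : nat -> X).
Hypothesis (HdX : is_metric dX).

(* [bump s i] is supported in the set of points that are within [1 + 2 s] of
   [D i] but farther than 1 from [D 0], ..., [D (i-1)]; these sets form a
   point-finite cover with Lebesgue number [s]. *)
Fixpoint clearance (s i : nat) (x : X) : R :=
  match i with
  | 0%nat => 1 + 2 * INR s
  | S i' => Rmin (clearance s i' x) (dX x (D i') - 1)
  end.

Definition bump (s i : nat) (x : X) : R :=
  Rmax 0 (Rmin (clearance s i x) (1 + 2 * INR s - dX x (D i))).

Lemma Rmin_lipschitz (a a' b b' r : R) :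
  Rabs (a - a') <= r -> Rabs (b - b') <= r -> Rabs (Rmin a b - Rmin a' b') <= r.
Proof.
  unfold Rmin; intros Ha Hb; apply Rabs_le_between in Ha, Hb; apply Rabs_le.
  do 2 destruct Rle_dec; lra.
Qed.

Lemma metric_lipschitz (x y z : X) : Rabs (dX x z - dX y z) <= dX x y.
Proof.
  destruct HdX as [_ [_ [_ [Hsym Htri]]]]; apply Rabs_le.
  generalize (Htri x y z) (Htri y x z); rewrite (Hsym y x); lra.
Qed.

Lemma clearance_lipschitz (s i : nat) (x y : X) :
  Rabs (clearance s i x - clearance s i y) <= dX x y.
Proof.
  induction i as [|i IH]; cbn [clearance].
  - rewrite Rminus_diag, Rabs_R0; apply HdX.
  - apply Rmin_lipschitz; auto.
    replace (_ - _) with (dX x (D i) - dX y (D i)) by ring.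
    apply metric_lipschitz.
Qed.

Lemma bump_lipschitz (s i : nat) (x y : X) :
  Rabs (bump s i x - bump s i y) <= dX x y.
Proof.
  unfold bump; assert (H := Rmin_lipschitz _ _ (1 + 2 * INR s - dX x (D i))
    (1 + 2 * INR s - dX y (D i)) _ (clearance_lipschitz s i x y)).
  assert (H' : Rabs (1 + 2 * INR s - dX x (D i) - (1 + 2 * INR s - dX y (D i)))
    <= dX x y).
  { replace (_ - _) with (- (dX x (D i) - dX y (D i))) by ring.
    rewrite Rabs_Ropp; apply metric_lipschitz. }
  specialize (H H'); apply Rabs_le_between in H; apply Rabs_le.
  unfold Rmax; do 2 destruct Rle_dec; lra.
Qed.

Lemma clearance_le (s i j : nat) (x : X) :
  (j < i)%nat -> clearance s i x <= dX x (D j) - 1.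
Proof.
  induction i as [|i IH]; intros Hj; [lia|]; cbn [clearance].
  destruct (Nat.eq_dec j i) as [->|Hne]; [apply Rmin_r|].
  apply Rle_trans with (1 := Rmin_l _ _), IH; lia.
Qed.

Lemma clearance_ge (s i : nat) (x : X) :
  (forall j, (j < i)%nat -> 1 + INR s <= dX x (D j)) -> INR s <= clearance s i x.
Proof.
  induction i as [|i IH]; intros H; cbn [clearance].
  - generalize (pos_INR s); lra.
  - apply Rmin_glb; [apply IH; auto|].
    specialize (H i (Nat.lt_succ_diag_r i)); lra.
Qed.

Lemma bump_bounds (s i : nat) (x : X) : 0 <= bump s i x <= 1 + 2 * INR s.
Proof.
  unfold bump; split; [apply Rmax_l|].
  generalize (pos_INR s) (proj1 HdX x (D i)); intros.
  apply Rmax_lub; [lra|]; apply Rle_trans with (1 := Rmin_r _ _); lra.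
Qed.

Lemma bump_eventually_zero (s i j : nat) (x : X) :
  dX x (D j) < 1 -> (j < i)%nat -> bump s i x = 0.
Proof.
  intros Hx Hj; apply Rmax_left.
  apply Rle_trans with (1 := Rmin_l _ _).
  generalize (clearance_le s i j x Hj); lra.
Qed.

(** Take the first [D i] within [1 + s] of [x]. Earlier centres leave clearance [s], so the bump at
    [x] is at least [s]; [y] is at least [1 + 2 s] away from [D i], where the bump vanishes. *)
Lemma bump_separates (s : nat) (x y : X) :
  (exists k, dX x (D k) < 1) -> 2 + 3 * INR s <= dX x y ->
  exists i, INR s <= Rabs (bump s i x - bump s i y).
Proof.
  intros [k Hk] Hxy; generalize (pos_INR s); intros Hs.
  assert (Hmin : exists i, dX x (D i) < 1 + INR s /\
    forall j, (j < i)%nat -> 1 + INR s <= dX x (D j)).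
  { assert (Hk' : dX x (D k) < 1 + INR s) by lra; clear Hk.
    induction k as [k IH] using (well_founded_induction lt_wf).
    destruct (classic (exists j, (j < k)%nat /\ dX x (D j) < 1 + INR s))
      as [[j [Hj Hj']]|Hn]; [eauto|].
    exists k; split; auto; intros j Hj; apply Rnot_lt_le; eauto. }
  destruct Hmin as [i [Hi Hfirst]]; exists i.
  assert (Hx : INR s <= bump s i x).
  { apply Rle_trans with (2 := Rmax_r _ _), Rmin_glb; [|lra].
    now apply clearance_ge. }
  assert (Hy : bump s i y = 0).
  { apply Rmax_left, Rle_trans with (1 := Rmin_r _ _).
    destruct HdX as [_ [_ [_ [Hsym Htri]]]].
    generalize (Htri x (D i) y); rewrite (Hsym (D i) y); lra. }
  rewrite Hy, Rminus_0_r, Rabs_pos_eq; lra.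
Qed.

End Aharoni.

(** Coordinate [i] carries scale [i mod (k + 1)] and centre [i / (k + 1)]. Having finitely many
    scales keeps the image in c_0 and bounds its norm by [1 + 2 k]. *)
Lemma bounded_metric_into_c0 (X : Type) (dX : X -> X -> R) (D : nat -> X) :
  is_metric dX -> (forall x, exists k, dX x (D k) < 1) -> bounded_metric dX ->
  exists (n : nat) (phi : X -> nat -> R), forall x y,
    c0 (phi x) /\ supnorm (phi x) <= INR n /\
    Rmax 0 ((dX x y - 5) / 5) <= supnorm (fun i => phi x i - phi y i) <= dX x y.
Proof.
  intros HdX HD [K HK]; destruct (INR_unbounded K) as [k Hk].
  exists (1 + 2 * k)%nat, (fun x i => bump X dX D (i mod (S k)) (i / S k) x).
  intros x y; split; [|split].
  - destruct (HD x) as [j Hj].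
    apply is_lim_seq_ext_loc with (fun _ => 0); [|apply is_lim_seq_const].
    exists (S k * S j)%nat; intros i Hi; symmetry.
    apply bump_eventually_zero with j; auto.
    apply Nat.div_le_lower_bound; auto.
  - apply supnorm_le; intros i.
    destruct (bump_bounds X dX D HdX (i mod S k) (i / S k) x) as [H1 H2].
    rewrite Rabs_pos_eq by exact H1; apply Rle_trans with (1 := H2).
    assert (Hi : (i mod S k <= k)%nat).
    { apply Nat.lt_succ_r, Nat.mod_upper_bound; auto. }
    apply le_INR in Hi; rewrite plus_INR, mult_INR; change (INR 1) with 1; change (INR 2) with 2; lra.
  - assert (Hb : forall i, Rabs (bump X dX D (i mod S k) (i / S k) x
                   - bump X dX D (i mod S k) (i / S k) y) <= dX x y).
    { intros i; apply bump_lipschitz, HdX. }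
    split; [|now apply supnorm_le].
    apply Rmax_lub; [apply supnorm_pos; eauto|].
    destruct (Rle_lt_dec (dX x y) 5) as [H5|H5].
    { apply Rle_trans with 0; [lra|apply supnorm_pos; eauto]. }
    (* The largest scale with [2 + 3 s <= dX x y]; it exceeds [(dX x y - 5) / 3]. *)
    set (s := natfloor ((dX x y - 2) / 3)).
    destruct (natfloor_bounds ((dX x y - 2) / 3)) as [Hs1 Hs2]; [lra|].
    fold s in Hs1, Hs2.
    destruct (bump_separates X dX D HdX s x y (HD x)) as [i Hi]; [lra|].
    assert (Hsk : (s < S k)%nat).
    { apply INR_lt; rewrite S_INR; specialize (HK x y); lra. }
    apply Rle_trans with (INR s); [lra|].
    apply Rle_trans with (1 := Hi).
    (* The coordinate of scale [s] and centre [i]. *)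
    assert (Hub := supnorm_ub _ (s + i * S k)%nat (ex_intro _ _ Hb)).
    cbv beta in Hub.
    rewrite Nat.Div0.mod_add, Nat.div_add, Nat.mod_small, Nat.div_small in Hub
      by auto.
    exact Hub.
Qed.

(** * Balls of c_0 and bounded separable spaces in M *)

Theorem theorem4p2 (M : Type) (d : M -> M -> R)
  (Hmet : is_metric d) (Hsep : separable d)
  (P : bord -> Prop) (HP : fund_system P)
  (Hemb : forall a, P a -> coarse_embeds (schreierZ a) dinfZ d) :
  (exists (m0 : M) (rho omega : R -> R), gauges rho omega /\
     exists F : nat -> (nat -> R) -> M,
       forall n : nat,
         F n (fun _ => 0) = m0 /\
         forall x y : nat -> R,
           c0 x -> supnorm x <= INR n -> c0 y -> supnorm y <= INR n ->
           rho (supnorm (fun i => x i - y i)) <= d (F n x) (F n y)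
             <= omega (supnorm (fun i => x i - y i)))
  /\
  (exists rho omega : R -> R, gauges rho omega /\
     forall (X : Type) (dX : X -> X -> R),
       is_metric dX -> separable dX -> bounded_metric dX ->
       exists f : X -> M, forall x y,
         rho (dX x y) <= d (f x) (f y) <= omega (dX x y)).
Proof.
  assert (HA : cofinal P).
  { intros t Ht; destruct HP as [_ [_ [_ [Hex _]]]].
    destruct (Hex t Ht) as [s [Hs [Hle _]]]; eauto. }
  assert (HM : exists D : nat -> M, forall p, exists k, d p (D k) < 1).
  { destruct (cofinal_inhabited P HA) as [a Ha].
    destruct (Hemb a Ha) as [f _].
    exact (dense_sequence M d (f (fun _ => 0%Z)) Hsep). }
  destruct HM as [D HD].
  destruct (uniform_profile M d D P Hmet HD HA Hemb) as [c [T [L [HT HJ]]]].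
  set (rho t := INR (lower_gauge T (natfloor t - 1))).
  set (omega t := INR (max_upto L (natfloor t + 1))).
  assert (Hg : gauges rho omega) by exact (gauges_of_sequences T L HT).
  (* Only the number of gauge values read depends on [n]; [c], [T] and [L] do not, so all balls
     share the base point and the gauges. *)
  destruct (functional_choice _ (fun n =>
    grid_embedding M d D c n T L (2 * n + 1) (HJ (2 * n + 1)%nat))) as [G HG].
  set (F n (x : nat -> R) := D (G n (fun i => round (x i)))).
  assert (HF : forall n x y,
    c0 x -> supnorm x <= INR n -> c0 y -> supnorm y <= INR n ->
    rho (supnorm (fun i => x i - y i)) <= d (F n x) (F n y)
      <= omega (supnorm (fun i => x i - y i))).
  { intros n x y Hx Hxn Hy Hyn; apply (profile_round T L n); auto; [apply Hmet|].
    destruct (round_grid n x Hx Hxn) as [kx Hkx].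
    destruct (round_grid n y Hy Hyn) as [ky Hky].
    apply (proj2 (HG n) (Nat.max kx ky)).
    - apply grid_le with (2 := Hkx); lia.
    - apply grid_le with (2 := Hky); lia. }
  split.
  - exists (D c), rho, omega; split; auto.
    exists F; intros n; split; auto.
    unfold F; rewrite round_zero; f_equal; apply HG.
  - exists (fun t => rho (Rmax 0 ((t - 5) / 5))), omega; split.
    { apply gauges_comp; [lra|exact Hg]. }
    intros X dX HdX HsX HbX.
    (* A dense sequence needs a base point; on the empty space any map works. *)
    destruct (classic (inhabited X)) as [[x0]|Hempty].
    + destruct (dense_sequence X dX x0 HsX) as [DX HDX].
      destruct (bounded_metric_into_c0 X dX DX HdX HDX HbX) as [n [phi Hphi]].
      exists (fun x => F n (phi x)); intros x y.
      destruct (Hphi x y) as [Hx [Hxn [Hlo Hup]]].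
      destruct (Hphi y x) as [Hy [Hyn _]].
      destruct (HF n _ _ Hx Hxn Hy Hyn) as [H1 H2].
      assert (H0 := Rmax_l 0 ((dX x y - 5) / 5)).
      destruct Hg as [Hmono _]; split.
      * apply Rle_trans with (2 := H1), Hmono; auto.
      * apply Rle_trans with (1 := H2), Hmono; auto; lra.
    + exists (fun _ => D 0%nat); intros x; exfalso; auto.
Qed.
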